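(* Let $\Lambda$ be an algebra admitting a simple projective module $P$. The poset $\mathrm{tors}\,\Lambda$ has a flip-flop decomposition given by $$(\mathrm{tors}\,\Lambda,\subseteq)\simeq\bigl(\mathrm{tors}_P\Lambda\sqcup(\mathrm{tors}\,\Lambda\setminus\mathrm{tors}_P\Lambda),\leq^f_-\bigr)$$ which restricts to a flip-flop decomposition of $\mathrm{ff\text{-}tors}\,\Lambda$, namely $$(\mathrm{ff\text{-}tors}\,\Lambda,\subseteq)\simeq\bigl(\mathrm{ff\text{-}tors}_P\Lambda\sqcup(\mathrm{ff\text{-}tors}\,\Lambda\setminus\mathrm{ff\text{-}tors}_P\Lambda),\leq^f_-\bigr).$$
   Context: Fix a field $k$. All algebras are basic and finite dimensional over $k$; $\mathrm{mod}\,\Lambda$ is the category of finitely generated right $\Lambda$-modules. A subcategory means a full subcategory closed under isomorphisms, finite direct sums and direct summands. A torsion pair in $\mathrm{mod}\,\Lambda$ is a pair $(\mathcal T,\mathcal F)$ of subcategories with $\mathrm{Hom}_\Lambda(\mathcal T,\mathcal F)=0$ such that every module $X$ fits in a short exact sequence $0\to tX\to X\to fX\to 0$ with $tX\in\mathcal T$, $fX\in\mathcal F$; then $\mathcal T$ is a torsion class. $\mathrm{tors}\,\Lambda$ (resp. $\mathrm{ff\text{-}tors}\,\Lambda$) is the poset of torsion classes (resp. functorially finite torsion classes: those admitting left and right approximations of every module), ordered by inclusion. Put ${}^\perp P=\{X\in\mathrm{mod}\,\Lambda\mid\mathrm{Hom}_\Lambda(X,P)=0\}$, $\mathrm{tors}_P\Lambda=\{\mathcal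 T\in\mathrm{tors}\,\Lambda\mid P\in\mathcal T\}$ and $\mathrm{ff\text{-}tors}_P\Lambda=\mathrm{tors}_P\Lambda\cap\mathrm{ff\text{-}tors}\,\Lambda$, all with the induced order. The map $f:\mathrm{tors}_P\Lambda\to\mathrm{tors}\,\Lambda\setminus\mathrm{tors}_P\Lambda$ is $f(\mathcal T)=\mathcal T\cap{}^\perp P$ (equivalently, the indecomposables of $f(\mathcal T)$ are those of $\mathcal T$ other than $P$); its restriction $\mathrm{ff\text{-}tors}_P\Lambda\to\mathrm{ff\text{-}tors}\,\Lambda\setminus\mathrm{ff\text{-}tors}_P\Lambda$ is again denoted $f$. For posets $X,Y$ and an order-preserving map $f:X\to Y$, the partial order $\leq^f_-$ on $X\sqcup Y$ restricts to the given orders on $X$ and $Y$, satisfies $y\leq^f_-x\iff y\leq_Y f(x)$ for $x\in X$, $y\in Y$, and has no other relations. The isomorphisms in the claim are the identity on underlying sets. *)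

(* Defs.v *)
From mathcomp Require Import all_boot all_algebra falgebra.

Set Implicit Arguments.
Unset Strict Implicit.
Unset Printing Implicit Defensive.

Import GRing.Theory.
Local Open Scope ring_scope.

(* Right modules over A are left modules over the converse ring A^c: for
   x : M and a : A, the product x a is (a : A^c) *: x. *)
Notation rmodType A := (lmodType A^c).

Section ModuleCategory.
Context {k : fieldType} {A : falgType k}.

Definition is_zero (M : rmodType A) := forall x : M, x = 0.

Definition fin_gen (M : rmodType A) :=
  exists n (g : 'I_n -> M), forall x : M,
    exists c : 'I_n -> A^c, x = \sum_(i < n) c i *: g i.

Definition isomorphic (M N : rmodType A) :=
  exists f : {linear M -> N}, bijective f.

Record fgmod := FgMod { fgmod_sort :> rmodType A; fgmodP : fin_gen fgmod_sort }.

Definition simple (M : fgmod) :=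
  ~ is_zero M /\
  forall S : {pred M}, submod_closed S ->
    (forall x, x \in S -> x = 0) \/ (forall x, x \in S).

Definition projective (P : fgmod) :=
  forall (M N : fgmod) (p : {linear M -> N}) (f : {linear P -> N}),
    (forall y, exists x, p x = y) ->
    exists g : {linear P -> M}, forall x, p (g x) = f x.

Definition indecomposable (M : fgmod) :=
  ~ is_zero M /\
  forall X Y : fgmod, isomorphic M (X * Y)%type -> is_zero X \/ is_zero Y.

Definition hom_zero (X Y : fgmod) :=
  forall (f : {linear X -> Y}) (x : X), f x = 0.

Definition short_exact (X Y Z : fgmod) (i : {linear X -> Y})
    (p : {linear Y -> Z}) :=
  [/\ injective i,
      forall y, p y = 0 <-> exists x, i x = y
    & forall z, exists y, p y = z].

(* A full subcategory is given by its class of objects, as a Prop-valued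
   predicate: the type set of mathcomp-classical cannot hold predicates on a
   type as large as fgmod (universe constraints). *)
Definition class := fgmod -> Prop.

Definition subcategory (C : class) :=
  [/\ forall X : fgmod, is_zero X -> C X,
      forall X Y : fgmod, isomorphic X Y -> C X -> C Y
    & forall X Y Z : fgmod, isomorphic Z (X * Y)%type -> (C Z <-> C X /\ C Y)].

Definition torsion_pair (T F : class) :=
  [/\ subcategory T, subcategory F,
      forall X Y : fgmod, T X -> F Y -> hom_zero X Y
    & forall X : fgmod, exists (tX fX : fgmod)
        (i : {linear tX -> X}) (p : {linear X -> fX}),
        [/\ T tX, F fX & short_exact i p]].

Definition left_approximation (C : class) (X C0 : fgmod)
    (f : {linear X -> C0}) :=
  C C0 /\
  forall (C1 : fgmod) (g : {linear X -> C1}), C C1 ->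
    exists h : {linear C0 -> C1}, forall x, g x = h (f x).

Definition right_approximation (C : class) (X C0 : fgmod)
    (f : {linear C0 -> X}) :=
  C C0 /\
  forall (C1 : fgmod) (g : {linear C1 -> X}), C C1 ->
    exists h : {linear C1 -> C0}, forall x, g x = f (h x).

Definition functorially_finite (C : class) :=
  forall X : fgmod,
    (exists (C0 : fgmod) (f : {linear X -> C0}), left_approximation C f) /\
    (exists (C0 : fgmod) (f : {linear C0 -> X}), right_approximation C f).

Definition left_perp (P : fgmod) : class := fun X => hom_zero X P.

End ModuleCategory.

Arguments fgmod {k} A.
Arguments class {k} A.

Definition tors (k : fieldType) (A : falgType k) : class A -> Prop :=
  fun T => exists F, torsion_pair T F.
Arguments tors {k} A.

Definition ff_tors (k : fieldType) (A : falgType k) : class A -> Prop :=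
  fun T => tors A T /\ functorially_finite T.
Arguments ff_tors {k} A.

Definition tors_at (k : fieldType) (A : falgType k) (P : fgmod A) :
    class A -> Prop :=
  fun T => tors A T /\ T P.

Definition ff_tors_at (k : fieldType) (A : falgType k) (P : fgmod A) :
    class A -> Prop :=
  fun T => tors_at P T /\ ff_tors A T.

(* The regular right module is the direct sum of pairwise non-isomorphic
   indecomposable modules; the module (A^c)^o is A acting on itself by right
   multiplication, since a *: x = x * a there. *)
Definition basic (k : fieldType) (A : falgType k) :=
  exists n (M : 'I_n -> fgmod A) (i : forall j, {linear M j -> (A^c)^o}),
    [/\ forall j, indecomposable (M j),
        forall j l, j != l -> ~ isomorphic (M j) (M l)
      & forall x : (A^c)^o, exists! m : forall j, M j, x = \sum_j i j (m j)].

Definition flip_flop_le (X Y : Type) (leX : X -> X -> Prop)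
    (leY : Y -> Y -> Prop) (f : X -> Y) (u v : X + Y) : Prop :=
  match u, v with
  | inl x, inl x' => leX x x'
  | inr y, inr y' => leY y y'
  | inr y, inl x => leY y (f x)
  | inl _, inr _ => False
  end.

Definition incl (U : Type) (C D : U -> Prop) : Prop := forall x, C x -> D x.

Definition inter (U : Type) (C D : U -> Prop) : U -> Prop :=
  fun x => C x /\ D x.

Definition minus (U : Type) (C D : U -> Prop) : U -> Prop :=
  fun x => C x /\ ~ D x.

(* A family S of classes is a poset under inclusion, with carrier sig S. *)
Definition sub_incl (U : Type) (S : (U -> Prop) -> Prop) (T T' : sig S) : Prop :=
  incl (sval T) (sval T').

Definition underlying (U : Type) (X Y : (U -> Prop) -> Prop)
    (u : sig X + sig Y) : U -> Prop :=
  match u with inl x => sval x | inr y => sval y end.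

(* The isomorphism is required to be the identity on underlying sets. *)
Definition flip_flop_decomposition (U : Type) (S X Y : (U -> Prop) -> Prop)
    (f : sig X -> sig Y) :=
  {homo f : T T' / sub_incl T T' >-> sub_incl T T'} /\
  exists h : sig S -> (sig X + sig Y)%type,
    [/\ bijective h,
        forall T, underlying (h T) = sval T
      & forall T T',
          sub_incl T T' <->
          flip_flop_le (@sub_incl U X) (@sub_incl U Y) f (h T) (h T')].

(* Main.v *)
Require Import Defs.
From HB Require Import structures.
From mathcomp Require Import all_boot all_algebra falgebra.
From mathcomp Require Import boolp.

Set Implicit Arguments.
Unset Strict Implicit.
Unset Printing Implicit Defensive.

Import GRing.Theory.
Local Open Scope ring_scope.
Local Open Scope quotient_scope.

(** Let P be simple and projective.  A nonzero map from a module M to P is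
    onto, because P is simple, and it splits, because P is projective; by
    induction on the dimension over k, every module is isomorphic to K + P^m
    with Hom(K, P) = 0 ([decomposition]).

    A torsion class T therefore contains P as soon as it contains a module
    with a nonzero map to P, so a torsion class T' that omits P lies in the
    left perp of P ([torsion_left_perp]), and T' is contained in a torsion
    class T exactly when it is contained in f(T), the intersection of T with
    the left perp of P.  A class containing P is never contained in one that
    omits it.  These facts are all that the order of a flip-flop
    decomposition asks for ([flip_flop_criterion]); it remains to see that f
    takes (functorially finite) torsion classes to classes of the same kind.

    If tX is the T-torsion part of X and tX = K + P^m as above, then K is the
    f(T)-torsion part of X: a module of f(T) has no nonzero map to X / K,
    which is an extension of X / tX by P^m ([tors_inter_left_perp]).

    Now let T be functorially finite.  Right approximations by f(T) come from
    the torsion pair.  For the left ones, let X -> K + P^m be a left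
    approximation by T; it is enough to approximate P by some Q in f(T), since
    then X -> K + Q^m is a left approximation by f(T)
    ([ff_inter_left_perp]).  To approximate P, let M + P^m be a left
    approximation of the regular module by T.  Every X in f(T) is a quotient
    of a power of M + P^m, and even of a power of M, because the summands P
    cannot contribute to generating a module that has no nonzero map to P
    ([superfluous_source_simple], [inter_left_perp_generator]).  By projectivity
    a map from P to X lifts to a power of M, hence factors through the map
    P -> M^n whose components span Hom(P, M) over k; this map is the left
    approximation of P ([simple_left_approximation]). *)

(** * Linear maps, submodules and quotient modules *)

Definition mklinear (R : pzRingType) (U V : lmodType R) (f : U -> V)
  (f_lin : linear f) : {linear U -> V} :=
  HB.pack f (GRing.isLinear.Build R U V *:%R f f_lin).

Section SubmoduleQuotient.
Variables (R : nzRingType) (V : lmodType R) (S : {pred V}).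
Hypothesis S_closed : submod_closed S.

Let S_submod : submodClosed V :=
  HB.pack (S : V -> bool) (GRing.isSubmodClosed.Build R V S S_closed).

(** The submodule with carrier S, as a module of its own. *)
Record submodule := Submodule { submodule_val :> V; _ : submodule_val \in S_submod }.
HB.instance Definition _ := [isSub for submodule_val].
HB.instance Definition _ := [Choice of submodule by <:].
HB.instance Definition _ := [SubChoice_isSubLmodule of submodule by <:].

Let S_zmod : zmodClosed V := HB.pack (S : V -> bool)
  (GRing.isZmodClosed.Build V S (GRing.submod_closedB S_closed)).

(** The quotient of V by S: the quotient of additive groups, on which a scalar
    acts through a choice of representatives. *)
Definition quotient_module := Quotient.quot S_zmod.
HB.instance Definition _ := GRing.Zmodule.on quotient_module.
Let pi : V -> quotient_module := \pi_(Quotient.quot S_zmod).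

Let piP x y : pi x = pi y <-> x - y \in S.
Proof. by rewrite (Quotient.idealrBE S_zmod); split=> /eqP. Qed.

Definition quo_scale (a : R) (x : quotient_module) := pi (a *: repr x).

Lemma quo_scale_pi a v : quo_scale a (pi v) = pi (a *: v).
Proof.
apply/piP; rewrite -scalerBr; apply: (GRing.submod_closed_semi S_closed).2.
by apply/piP; rewrite /pi reprK.
Qed.
Let quo_pi_ind (Q : quotient_module -> Prop) : (forall v, Q (pi v)) -> forall x, Q x.
Proof. by move=> Q_pi x; rewrite -[x]reprK; apply: Q_pi. Qed.
Let piD : {morph pi : x y / x + y}. Proof. exact: raddfD. Qed.
Fact quo_scaleA a b x : quo_scale a (quo_scale b x) = quo_scale (a * b) x.
Proof. by elim/quo_pi_ind: x => x; rewrite !quo_scale_pi scalerA. Qed.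
Fact quo_scale1 : left_id 1 quo_scale.
Proof. by elim/quo_pi_ind=> x; rewrite quo_scale_pi scale1r. Qed.
Fact quo_scaleDr : right_distributive quo_scale +%R.
Proof.
move=> a; elim/quo_pi_ind=> x; elim/quo_pi_ind=> y.
by rewrite -piD !quo_scale_pi scalerDr piD.
Qed.
Fact quo_scaleDl x : {morph quo_scale^~ x : a b / a + b}.
Proof. by elim/quo_pi_ind: x => x a b; rewrite !quo_scale_pi scalerDl piD. Qed.
HB.instance Definition _ := GRing.Zmodule_isLmodule.Build R quotient_module
  quo_scaleA quo_scale1 quo_scaleDr quo_scaleDl.

Lemma exists_submodule : exists (W : lmodType R) (i : {linear W -> V}),
  injective i /\ forall x, x \in S <-> exists y, i y = x.
Proof.
exists submodule, \val; split=> [|x]; first exact: val_inj.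
by split=> [xS|[[y yS] <-]] //; exists (@Submodule x xS).
Qed.

Lemma exists_quotient : exists (W : lmodType R) (p : {linear V -> W}),
  (forall z, exists x, p x = z) /\ forall x, p x = 0 <-> x \in S.
Proof.
have pi_lin : linear pi by move=> a x y; rewrite piD -quo_scale_pi.
exists quotient_module, (mklinear pi_lin).
split=> [z|x] /=; first by exists (repr z); rewrite /pi reprK.
rewrite -[x in x \in S]subr0 -piP [pi 0](_ : _ = 0) //.
exact: (raddf0 (mklinear pi_lin)).
Qed.
End SubmoduleQuotient.

(** A spanning family indexed by any finite type can be reindexed by an initial
    segment of nat. *)
Lemma span_enum (R : nzRingType) (V : lmodType R) (I : finType) (g : I -> V) :
  (forall x, exists c : I -> R, x = \sum_i c i *: g i) ->
  exists n (e : 'I_n -> V), forall x, exists c : 'I_n -> R, x = \sum_(i < n) c i *: e i.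
Proof.
move=> g_span; exists #|I|, (g \o enum_val) => x; have [c ->] := g_span x.
by exists (c \o enum_val); rewrite (big_enum_val (fun i => c i *: g i)).
Qed.

(** * Dimension over the field *)

Section FiniteDimension.
Variable k : fieldType.

(** The family v is linearly independent. *)
Definition free_family (V : lmodType k) n (v : 'I_n -> V) :=
  forall c : 'I_n -> k, \sum_(i < n) c i *: v i = 0 -> forall i, c i = 0.

(** V has dimension at most d: no linearly independent family has more than d
    members. *)
Definition dim_le (V : lmodType k) (d : nat) :=
  forall n (v : 'I_n -> V), free_family v -> (n <= d)%N.

(** The family v with x put in front. *)
Definition extend_family (V : Type) n (x : V) (v : 'I_n -> V) (i : 'I_n.+1) :=
  if unlift ord0 i is Some j then v j else x.

Lemma free_family_extend (V : lmodType k) n (x : V) (v : 'I_n -> V) :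
  free_family v -> (forall c, x <> \sum_(i < n) c i *: v i) ->
  free_family (extend_family x v).
Proof.
move=> v_free x_out c; rewrite big_ord_recl /extend_family unlift_none => c_rel.
have {}c_rel : c ord0 *: x + \sum_(i < n) c (lift ord0 i) *: v i = 0.
  by rewrite -[RHS]c_rel; congr (_ + _); apply: eq_bigr => i _; rewrite liftK.
have c0 : c ord0 = 0.
  apply/eqP/negP=> /negP c0_neq0.
  apply: (x_out (fun i => - (c ord0)^-1 * c (lift ord0 i))).
  under eq_bigr do rewrite -scalerA.
  rewrite -scaler_sumr; apply: (scalerI c0_neq0).
  by rewrite scalerA mulrN divff // scaleN1r; apply/eqP; rewrite -addr_eq0 c_rel.
move: c_rel; rewrite c0 scale0r add0r => /v_free c_lift i.
by case: (unliftP ord0 i) => [j|] ->.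
Qed.

(** More vectors than members of e have a linear relation, read off from the
    left kernel of the matrix of their coefficients. *)
Lemma spanned_dim_le (V : lmodType k) d (e : 'I_d -> V) :
  (forall x, exists c : 'I_d -> k, x = \sum_(i < d) c i *: e i) -> dim_le V d.
Proof.
move=> e_span n v v_free; rewrite leqNgt; apply/negP=> d_lt_n.
have [a v_def] := choice (fun i => e_span (v i)).
pose m := \matrix_(i, j) a i j.
have : kermx m != 0.
  by rewrite kermx_eq0 /row_free ltn_eqF // (leq_ltn_trans (rank_leq_col m)).
case/rowV0Pn=> u /sub_kermxP um0 /negP; apply; apply/eqP/rowP=> i; rewrite mxE.
apply: (v_free (fun i => u 0 i)).
under eq_bigr do rewrite v_def scaler_sumr.
rewrite exchange_big big1 //= => j _.
under eq_bigr do rewrite scalerA.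
rewrite -scaler_suml; move/rowP/(_ j): um0; rewrite !mxE => um0.
by under eq_bigr => l _ do [have -> : a l j = m l j by rewrite mxE]; rewrite um0 scale0r.
Qed.

(** The set S need not be a subspace: a maximal independent family in S spans
    S. *)
Lemma dim_le_finite_span (V : lmodType k) d (S : V -> Prop) : dim_le V d ->
  exists n (b : 'I_n -> V), (forall i, S (b i)) /\
    forall x, S x -> exists c : 'I_n -> k, x = \sum_(i < n) c i *: b i.
Proof.
move=> V_dim; apply: contrapT => no_span.
suff free_in_S n : exists v : 'I_n -> V, free_family v /\ forall i, S (v i).
  (* independent families in S of every length contradict the bound d *)
  by have [v [/V_dim]] := free_in_S d.+1; rewrite ltnn.
elim: n => [|n [v [v_free v_S]]]; first by exists (fun=> 0); split=> [c _|] [].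
apply: contrapT => no_ext; apply: no_span; exists n, v; split=> // x x_S.
apply: contrapT => x_out; apply: no_ext; exists (extend_family x v); split.
  by apply: free_family_extend => // c x_def; apply: x_out; exists c.
by move=> i; rewrite /extend_family; case: unlift.
Qed.

Lemma dim_le0 (V : lmodType k) : dim_le V 0 -> forall x : V, x = 0.
Proof.
move=> V0 x; apply: contrapT => x_neq0.
suff /V0 : free_family (extend_family x (fun _ : 'I_0 => x)) by [].
apply: free_family_extend; first by move=> c _ [].
by move=> c; rewrite big_ord0.
Qed.

(** The dimension drops on passing to the kernel of a nonzero map. *)
Lemma dim_le_proper (U V W : lmodType k) (i : {linear U -> V})
    (f : {linear V -> W}) d :
  injective i -> (forall u, f (i u) = 0) -> (exists v, f v <> 0) ->
  dim_le V d.+1 -> dim_le U d.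
Proof.
move=> i_inj fi0 [x fx_neq0] V_dim n v v_free.
rewrite -ltnS; apply: (V_dim _ (extend_family x (i \o v))).
apply: free_family_extend.
  move=> c c_rel; apply: v_free; apply: i_inj; rewrite raddf0 -[RHS]c_rel.
  by rewrite linear_sum; apply: eq_bigr => j _; rewrite linearZ.
move=> c x_def; apply: fx_neq0; rewrite x_def linear_sum big1 // => j _.
by rewrite linearZZ fi0 scaler0.
Qed.
End FiniteDimension.

Section Restriction.
Context {k : fieldType} {A : falgType k}.

(** A right A-module seen as a vector space over k, through k -> A. *)
Definition over_k (M : rmodType A) : Type := M.
Section OverK.
Variable M : rmodType A.
HB.instance Definition _ := GRing.Zmodule.on (over_k M).
Definition k_scale (c : k) (x : over_k M) : over_k M := (c%:A : A^c) *: (x : M).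
Fact k_scaleA c d x : k_scale c (k_scale d x) = k_scale (c * d) x.
Proof.
rewrite /k_scale scalerA; congr (GRing.scale _ x).
by rewrite [LHS]/GRing.mul /= -scalerAl mul1r scalerA mulrC.
Qed.
Fact k_scale1 : left_id 1 k_scale.
Proof. by move=> x; rewrite /k_scale !scale1r. Qed.
Fact k_scaleDr : right_distributive k_scale +%R.
Proof. by move=> c x y; rewrite /k_scale scalerDr. Qed.
Fact k_scaleDl x : {morph k_scale^~ x : c d / c + d}.
Proof. by move=> c d; rewrite /k_scale scalerDl scalerDl. Qed.
HB.instance Definition _ := GRing.Zmodule_isLmodule.Build k (over_k M)
  k_scaleA k_scale1 k_scaleDr k_scaleDl.

Lemma k_scaleE (c : k) (x : over_k M) : c *: x = (c%:A : A^c) *: (x : M).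
Proof. by []. Qed.

Lemma k_scaleC (c : k) (a : A^c) (x : M) :
  c *: (a *: x : over_k M) = a *: (c *: (x : over_k M) : M).
Proof.
rewrite !k_scaleE !scalerA; congr (GRing.scale _ x).
by rewrite /GRing.mul /= -scalerAl -scalerAr mul1r mulr1.
Qed.
End OverK.

(** A map of A-modules is linear over k. *)
Definition over_k_linear (M N : rmodType A) (f : {linear M -> N}) :
  {linear over_k M -> over_k N}.
Proof.
by apply: (@mklinear _ _ _ (f : over_k M -> over_k N)) => c x y; rewrite linearP.
Defined.

Lemma fin_gen_dim_le (M : rmodType A) : fin_gen M -> exists d, dim_le (over_k M) d.
Proof.
case=> n [g g_gen]; pose b := vbasis {:A}.
have [x|d [e e_span]] := @span_enum k (over_k M) ('I_n * 'I_(\dim {:A}))%type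
    (fun p => (b`_p.2 : A^c) *: g p.1); last first.
  by exists d; apply: spanned_dim_le e_span.
have [a ->] := g_gen x; exists (fun p => coord b p.2 (a p.1)).
rewrite -(pair_bigA _ (fun i j =>
  coord b j (a i) *: ((b`_j : A^c) *: g i : over_k M))) /=.
apply: eq_bigr => i _; rewrite {1}(coord_vbasis (memvf (a i : A))) scaler_suml.
apply: eq_bigr => j _; rewrite k_scaleE scalerA; congr (GRing.scale _ (g i)).
by rewrite [RHS]/GRing.mul /= -scalerAr mulr1.
Qed.
End Restriction.

(** * Maps between finite products *)

Section LinearMaps.
Variable R : nzRingType.
Implicit Types U V W : lmodType R.

Lemma inj_surj_bijective (S T : Type) (f : S -> T) :
  injective f -> (forall y, exists x, f x = y) -> bijective f.
Proof.
by move=> f_inj /choice[g gK]; exists g => // x; apply: f_inj; rewrite gK.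
Qed.

Lemma linear_inj U V (f : {linear U -> V}) :
  (forall x, f x = 0 -> x = 0) -> injective f.
Proof.
move=> f_ker x y fxy; apply/eqP; rewrite -subr_eq0; apply/eqP; apply: f_ker.
by rewrite linearB fxy subrr.
Qed.

Lemma linear_bijective_inverse U V (f : {linear U -> V}) : bijective f ->
  exists g : {linear V -> U}, cancel f g /\ cancel g f.
Proof.
by case=> g fK gK; exists (mklinear (can2_linear fK gK)).
Qed.

Lemma factor_through_injection U V W (i : {linear V -> W}) (f : {linear U -> W}) :
  injective i -> (forall x, exists y, i y = f x) ->
  exists g : {linear U -> V}, forall x, i (g x) = f x.
Proof.
move=> i_inj /choice[g gE].
have g_lin : linear g by move=> a x y; apply: i_inj; rewrite linearP !gE linearP.
by exists (mklinear g_lin).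
Qed.

Lemma factor_through_surjection U V W (p : {linear U -> V}) (f : {linear U -> W}) :
  (forall z, exists x, p x = z) -> (forall x, p x = 0 -> f x = 0) ->
  exists g : {linear V -> W}, forall x, g (p x) = f x.
Proof.
move=> /choice[s sK] f_ker.
have gE x : f (s (p x)) = f x.
  apply/eqP; rewrite -subr_eq0 -linearB; apply/eqP; apply: f_ker.
  by rewrite linearB sK subrr.
have g_lin : linear (f \o s).
  move=> a x y /=; rewrite -linearP -[RHS]gE; congr (f (s _)).
  by rewrite linearP !sK.
by exists (mklinear g_lin).
Qed.

(** The maps into and out of products and powers given by their components. *)
Definition copair U V W (f : {linear U -> W}) (g : {linear V -> W}) :
  {linear (U * V)%type -> W}.
Proof.
apply: (@mklinear _ _ _ (fun x : (U * V)%type => f x.1 + g x.2)) => a x y /=.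
by rewrite !linearP scalerDr addrACA.
Defined.

Definition inj1 U V : {linear U -> (U * V)%type}.
Proof.
apply: (@mklinear _ _ _ (fun x : U => (x, 0 : V))) => a x y.
by congr pair; rewrite /= ?scaler0 ?addr0.
Defined.

Definition inj2 U V : {linear V -> (U * V)%type}.
Proof.
apply: (@mklinear _ _ _ (fun y : V => (0 : U, y))) => a x y.
by congr pair; rewrite /= ?scaler0 ?addr0.
Defined.

Definition proj1 U V : {linear (U * V)%type -> U}.
Proof. by apply: (@mklinear _ _ _ (fun x : (U * V)%type => x.1)). Defined.

Definition proj2 U V : {linear (U * V)%type -> V}.
Proof. by apply: (@mklinear _ _ _ (fun x : (U * V)%type => x.2)). Defined.

Definition pair_map U V W (f : {linear U -> V}) (g : {linear U -> W}) :
  {linear U -> (V * W)%type}.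
Proof.
apply: (@mklinear _ _ _ (fun x : U => (f x, g x))) => a x y.
by rewrite !linearP.
Defined.

Lemma pair_split U V (x : (U * V)%type) : x = inj1 U V x.1 + inj2 U V x.2.
Proof. by rewrite [LHS]surjective_pairing; congr pair; rewrite /= ?addr0 ?add0r. Qed.

Definition sum_map n U V (h : 'I_n -> {linear U -> V}) :
  {linear {ffun 'I_n -> U} -> V}.
Proof.
apply: (@mklinear _ _ _ (fun x : {ffun 'I_n -> U} => \sum_i h i (x i))) => a x y.
rewrite scaler_sumr -big_split; apply: eq_bigr => i _.
by rewrite !ffunE linearP.
Defined.

Definition tuple_map n U V (h : 'I_n -> {linear U -> V}) :
  {linear U -> {ffun 'I_n -> V}}.
Proof.
apply: (@mklinear _ _ _ (fun x : U => [ffun i => h i x] : {ffun 'I_n -> V})) => a x y.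
by apply/ffunP=> i; rewrite !ffunE linearP.
Defined.

Definition coord_map n U (i : 'I_n) : {linear {ffun 'I_n -> U} -> U}.
Proof.
by apply: (@mklinear _ _ _ (fun x : {ffun 'I_n -> U} => x i)) => a x y; rewrite !ffunE.
Defined.

Definition delta_map n U (i : 'I_n) : {linear U -> {ffun 'I_n -> U}}.
Proof.
apply: (@mklinear _ _ _ (fun x : U =>
  [ffun j => if j == i then x else 0] : {ffun 'I_n -> U})) => a x y.
by apply/ffunP=> j; rewrite !ffunE; case: eqP => //; rewrite scaler0 addr0.
Defined.

Lemma sum_delta n U (x : {ffun 'I_n -> U}) : x = \sum_i delta_map U i (x i).
Proof.
apply/ffunP=> j; rewrite sum_ffunE (bigD1 j) //= ffunE eqxx big1 ?addr0 // => i.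
by rewrite eq_sym ffunE => /negbTE ->.
Qed.

(** U * U^n is U^(n+1), the factor U being put in front. *)
Definition cons_map n U : {linear (U * {ffun 'I_n -> U})%type -> {ffun 'I_n.+1 -> U}}.
Proof.
apply: (@mklinear _ _ _ (fun x : (U * {ffun 'I_n -> U})%type =>
  finfun (extend_family x.1 x.2) : {ffun 'I_n.+1 -> U})) => a x y.
apply/ffunP=> i; rewrite !ffunE /extend_family.
by case: unliftP => [j|] _ //; rewrite !ffunE.
Defined.

Lemma cons_map_bijective n U : bijective (cons_map n U).
Proof.
exists (fun x : {ffun 'I_n.+1 -> U} =>
  (x ord0, [ffun j : 'I_n => x (lift ord0 j)])) => [[x y]|x] /=.
  rewrite ffunE /extend_family unlift_none; congr pair.
  by apply/ffunP=> j; rewrite !ffunE liftK.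
apply/ffunP=> i; rewrite ffunE /extend_family.
by case: unliftP => [j|] -> //=; rewrite ffunE.
Qed.
End LinearMaps.

(** * Finitely generated modules *)

Section Modules.
Context {k : fieldType} {A : falgType k}.

Lemma fin_gen_surj (M N : rmodType A) (p : {linear M -> N}) :
  (forall y, exists x, p x = y) -> fin_gen M -> fin_gen N.
Proof.
move=> p_surj [n [g g_gen]]; exists n, (p \o g) => y.
have [x <-] := p_surj y; have [c ->] := g_gen x; exists c.
by rewrite linear_sum; apply: eq_bigr => i _; rewrite linearZ.
Qed.

Lemma fin_gen_prod (M N : rmodType A) :
  fin_gen M -> fin_gen N -> fin_gen (M * N)%type.
Proof.
move=> [m [g g_gen]] [n [h h_gen]].
apply: (@span_enum _ _ ('I_m + 'I_n)%type
  (fun i => match i with inl i => inj1 M N (g i) | inr j => inj2 M N (h j) end)).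
move=> [x y]; have [c x_def] := g_gen x; have [d y_def] := h_gen y.
exists (fun i => match i with inl i => c i | inr j => d j end).
have -> : (x, y) = inj1 M N x + inj2 M N y by apply: pair_split.
rewrite big_sumType x_def y_def !linear_sum.
by congr (_ + _); apply: eq_bigr => i _; rewrite linearZ.
Qed.

Lemma fin_gen_pow n (M : rmodType A) : fin_gen M -> fin_gen {ffun 'I_n -> M}.
Proof.
move=> M_fg; elim: n => [|n IHn].
  exists 0, (fun=> 0) => x; exists (fun=> 0); rewrite big_ord0.
  by apply/ffunP=> -[].
apply: fin_gen_surj (fin_gen_prod M_fg IHn).
  by case: (cons_map_bijective n M) => g _ gK y; exists (g y); apply: gK.
Qed.

Lemma fin_gen_regular : fin_gen (A^c)^o.
Proof.
exists 1, (fun=> 1) => x; exists (fun=> x).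
by rewrite big_ord1 /GRing.scale /= mulr1.
Qed.

Definition prod_fg (M N : fgmod A) := FgMod (fin_gen_prod (fgmodP M) (fgmodP N)).
Definition pow_fg n (M : fgmod A) := FgMod (fin_gen_pow n (fgmodP M)).

(** A as a right module over itself. *)
Definition regular : fgmod A := FgMod fin_gen_regular.

(** The map from the regular module that takes 1 to x. *)
Definition from_regular (M : rmodType A) (x : M) : {linear regular -> M}.
Proof.
apply: (@mklinear _ _ _ (fun a : (A^c)^o => (a : A^c) *: x)) => a b c.
by rewrite scalerDl scalerA.
Defined.

Lemma isomorphic_of_bijective (M N : rmodType A) (f : {linear N -> M}) :
  bijective f -> isomorphic M N.
Proof.
by move=> /linear_bijective_inverse[g [fK gK]]; exists g; exists f.
Qed.

End Modules.

(** * A simple projective module *)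

Section SimpleProjective.
Context {k : fieldType} {A : falgType k}.
Variable P : fgmod A.
Hypothesis P_simple : simple P.

Lemma simple_nonzero : exists p : P, p <> 0.
Proof.
apply: contrapT => P0; apply: P_simple.1 => p.
by apply: contrapT => p0; apply: P0; exists p.
Qed.

Lemma simple_submodule (S : P -> Prop) :
  S 0 -> (forall a x y, S x -> S y -> S (a *: x + y)) ->
  (forall x, S x -> x = 0) \/ (forall x, S x).
Proof.
move=> S0 S_lin.
have [|S_zero|S_full] := P_simple.2 [pred x | `[< S x >]].
- split; first exact/asboolP.
  by move=> a x y /asboolP Sx /asboolP Sy; apply/asboolP/S_lin.
- by left=> x Sx; apply: S_zero; apply/asboolP.
- by right=> x; apply/asboolP/S_full.
Qed.

Lemma simple_linear_inj (N : rmodType A) (h : {linear P -> N}) :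
  (exists p, h p <> 0) -> injective h.
Proof.
case=> p hp; apply: linear_inj.
have [||//|h0] := @simple_submodule (fun x => h x = 0); first exact: raddf0.
  by move=> a x y hx hy; rewrite linearP hx hy scaler0 addr0.
by case: hp; apply: h0.
Qed.

Lemma simple_linear_surj (M : rmodType A) (h : {linear M -> P}) :
  (exists x, h x <> 0) -> forall p, exists x, h x = p.
Proof.
case=> x hx.
have [||h0|//] := @simple_submodule (fun p => exists x, h x = p).
- by exists 0; rewrite raddf0.
- by move=> a _ _ [y <-] [z <-]; exists (a *: y + z); rewrite linearP.
- by case: hx; apply: h0; exists x.
Qed.

Lemma simple_cyclic (p0 : P) : p0 <> 0 -> forall p, exists a : A^c, p = a *: p0.
Proof.
move=> p0_neq0.
have [||P0|//] := @simple_submodule (fun p => exists a : A^c, p = a *: p0).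
- by exists 0; rewrite scale0r.
- by move=> a _ _ [b ->] [c ->]; exists (a * b + c); rewrite scalerDl scalerA.
- by case: p0_neq0; apply: P0; exists 1; rewrite scale1r.
Qed.

Lemma not_hom_zero (M : fgmod A) : ~ hom_zero M P ->
  exists (h : {linear M -> P}) (x : M), h x <> 0.
Proof.
move=> hM; apply: contrapT => no_h; apply: hM => h x.
by apply: contrapT => hx; apply: no_h; exists h, x.
Qed.

Lemma left_perp_not_self : ~ left_perp P P.
Proof. by move=> P0; apply: P_simple.1 => p; apply: (P0 idfun p). Qed.

(** Maps from R do not help to generate X: if X is the sum of the image of a
    map i and of the image of a map from R, then i is already onto. *)
Definition superfluous_source (X R : rmodType A) :=
  forall (Y : rmodType A) (i : {linear Y -> X}) (g : {linear R -> X}),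
    (forall x, exists y r, x = i y + g r) -> forall x, exists y, x = i y.

(** Otherwise the cokernel of i is a nonzero quotient of P, hence isomorphic to
    P, and X has a nonzero map to P. *)
Lemma superfluous_source_simple (X : fgmod A) :
  left_perp P X -> superfluous_source X P.
Proof.
move=> X_perp Y i g sum_surj.
have im_closed : submod_closed [pred x | `[< exists y, x = i y >]].
  split; first by apply/asboolP; exists 0; rewrite raddf0.
  move=> a _ _ /asboolP[y ->] /asboolP[z ->]; apply/asboolP.
  by exists (a *: y + z); rewrite linearP.
have [Q [q [q_surj q_ker]]] := exists_quotient im_closed.
suff q0 x : q x = 0 by move=> x; apply/asboolP/q_ker.
have qg x' : exists p, q (g p) = q x'.
  have [y [p ->]] := sum_surj x'; exists p; rewrite linearD.
  have /q_ker -> : i y \in [pred x | `[< exists y, x = i y >]].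
    by apply/asboolP; exists y.
  by rewrite add0r.
apply: contrapT => qx.
have qg_bij : bijective (q \o g).
  apply: inj_surj_bijective; last by move=> z; have [x' <-] := q_surj z; apply: qg.
  apply: (@simple_linear_inj _ (q \o g)).
  by have [p qgp] := qg x; exists p; rewrite /= qgp.
have [e [eK _]] := linear_bijective_inverse qg_bij.
apply: qx; have [p <-] := qg x.
by have := X_perp (e \o q) (g p); rewrite /= eK => ->; rewrite !raddf0.
Qed.

(** The factors of R^n are removed one at a time. *)
Lemma superfluous_source_pow (X R : rmodType A) n :
  superfluous_source X R -> superfluous_source X {ffun 'I_n -> R}.
Proof.
move=> R_sup; elim: n => [|n IHn] Y i g sum_surj.
  move=> x; have [y [r ->]] := sum_surj x; exists y.
  by rewrite [r](_ : _ = 0) ?raddf0 ?addr0 //; apply/ffunP=> -[].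
pose g1 : {linear R -> X} := g \o (cons_map n R \o inj1 _ _).
pose g2 : {linear {ffun 'I_n -> R} -> X} := g \o (cons_map n R \o inj2 _ _).
apply: (R_sup _ i g1) => x.
have [|[y p] ->] := IHn _ (copair i g1) g2 _ x; last by exists y, p.
move=> {}x; have [y [r ->]] := sum_surj x.
have [u _ uK] := cons_map_bijective n R.
exists (y, (u r).1), (u r).2.
suff r_def : r = cons_map n R (inj1 _ _ (u r).1) + cons_map n R (inj2 _ _ (u r).2).
  by rewrite {1}r_def linearD addrA.
by rewrite -linearD -pair_split uK.
Qed.

Hypothesis P_projective : projective P.

(** Such a module M is the direct sum of K, the kernel of h, and of P. *)
Lemma projective_split (M : fgmod A) : ~ hom_zero M P ->
  exists (K : fgmod A) (h : {linear M -> P}) (i : {linear K -> M}) (s : {linear P -> M}),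
    [/\ cancel s h, injective i, forall x, h (i x) = 0
      & forall x, h x = 0 -> exists y, i y = x].
Proof.
move=> /not_hom_zero[h [x0 hx0]].
have h_surj := simple_linear_surj (ex_intro _ x0 hx0).
have [s sK] := @P_projective M P h idfun h_surj.
have ker_closed : submod_closed [pred x | h x == 0].
  split=> [|a x y]; first by rewrite inE raddf0.
  by rewrite !inE linearP => /eqP-> /eqP->; rewrite scaler0 addr0.
have [K [i [i_inj iE]]] := exists_submodule ker_closed.
have hE x : h x = 0 <-> exists y, i y = x by rewrite -iE inE; split=> /eqP.
(* K is finitely generated, as the image of M under the projection along P *)
have retr_lin : linear (fun x => x - s (h x)).
  by move=> a x y; rewrite !linearP scalerDr addrACA.
have [|r rE] := @factor_through_injection _ _ _ _ i (mklinear retr_lin) i_inj.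
  by move=> x; apply/hE; rewrite /= linearB sK subrr.
have K_fg : fin_gen K.
  apply: (@fin_gen_surj _ _ M K r _ (fgmodP M)) => y; exists (i y); apply: i_inj.
  have hiy : h (i y) = 0 by apply/hE; exists y.
  by rewrite rE /= hiy raddf0 subr0.
by exists (FgMod K_fg), h, i, s; split=> // x => [|/hE]; [apply/hE; exists x|].
Qed.

(** Every module is K + P^m with Hom(K, P) = 0. *)
Lemma decomposition (M : fgmod A) :
  exists (K : fgmod A) m (f : {linear (K * {ffun 'I_m -> P})%type -> M}),
    left_perp P K /\ bijective f.
Proof.
have no_summand (X : fgmod A) : left_perp P X ->
    exists (K : fgmod A) m (f : {linear (K * {ffun 'I_m -> P})%type -> X}),
      left_perp P K /\ bijective f.
  move=> X_perp; exists X, 0, (proj1 _ _); split=> //.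
  exists (fun x => (x, 0)) => // -[x r]; congr pair.
  by apply/ffunP=> -[].
have [d] := fin_gen_dim_le (fgmodP M).
elim: d M => [|d IHd] M M_dim.
  by apply: no_summand => h x; rewrite [x](dim_le0 M_dim) raddf0.
have [/no_summand //|] := pselect (left_perp P M).
move=> /projective_split[K [h [i [s [sK i_inj hi h_ker]]]]].
have [|K' [m [f [K'_perp f_bij]]]] := IHd K.
  have [p p_neq0] := simple_nonzero.
  apply: (@dim_le_proper _ _ _ _ (over_k_linear i) (over_k_linear h)) M_dim => //.
  by exists (s p); rewrite /= sK.
have [u [uK uV]] := linear_bijective_inverse (cons_map_bijective m P).
(* P^(m+1) is P * P^m: the factor P is sent to M by s, and K' * P^m by
   f and i *)
pose M' := (K' * {ffun 'I_m.+1 -> P})%type.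
pose head : {linear M' -> P} := proj1 _ _ \o (u \o proj2 _ _).
pose tail : {linear M' -> {ffun 'I_m -> P}} := proj2 _ _ \o (u \o proj2 _ _).
pose drop : {linear M' -> (K' * {ffun 'I_m -> P})%type} :=
  pair_map (proj1 _ _) tail.
have glue_lin : linear (fun x => i (f (drop x)) + s (head x)).
  by move=> a x y; rewrite !linearP scalerDr addrACA.
have [v [fK vK]] := linear_bijective_inverse f_bij.
exists K', m.+1, (mklinear glue_lin); split=> //; apply: inj_surj_bijective.
  apply: linear_inj => x glue0.
  have {}glue0 : i (f (drop x)) + s (head x) = 0 by [].
  have head0 : head x = 0.
    by move/(congr1 h): glue0; rewrite linearD hi add0r sK raddf0.
  move: glue0; rewrite head0 raddf0 addr0 => i0.
  have : drop x = 0.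
    apply: (can_inj fK); apply: i_inj; by rewrite i0 !raddf0.
  case: x head0 i0 => y r /= head0 _ [-> tail0]; congr pair.
  apply: (can_inj uV); rewrite raddf0 [LHS]surjective_pairing.
  by congr pair.
move=> x; have [|z iz] := h_ker (x - s (h x)).
  by rewrite linearB sK subrr.
pose r := cons_map m P (h x, (v z).2); exists ((v z).1, r).
suff : i (f ((v z).1, (u r).2)) + s (u r).1 = x by [].
by rewrite uK -surjective_pairing vK iz subrK.
Qed.
End SimpleProjective.

(** * Torsion classes *)

Section Subcategories.
Context {k : fieldType} {A : falgType k}.
Implicit Types (C T F : class A) (X Y Z P : fgmod A).

Lemma isomorphic_refl (M : rmodType A) : isomorphic M M.
Proof. by exists idfun; exists idfun. Qed.

Lemma subcategory_inter C D : subcategory C -> subcategory D ->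
  subcategory (inter C D).
Proof.
move=> [C0 C_iso C_sum] [D0 D_iso D_sum]; split=> [X X0|X Y XY [CX DX]|X Y Z ZXY].
- by split; [apply: C0|apply: D0].
- by split; [apply: C_iso CX|apply: D_iso DX].
- have := C_sum X Y Z ZXY; have := D_sum X Y Z ZXY; rewrite /inter; tauto.
Qed.

Lemma subcategory_prod C X Y : subcategory C -> C X -> C Y -> C (prod_fg X Y).
Proof.
by case=> _ _ C_sum CX CY; apply/(C_sum X Y (prod_fg X Y) (isomorphic_refl _)).
Qed.

Lemma subcategory_pow C X n : subcategory C -> C X -> C (pow_fg n X).
Proof.
move=> C_sub CX; have [C0 C_iso _] := C_sub; elim: n => [|n IHn].
  by apply: C0 => x; apply/ffunP=> -[].
apply: (C_iso (prod_fg X (pow_fg n X))); last exact: subcategory_prod.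
by exists (cons_map n X); apply: cons_map_bijective.
Qed.

Lemma subcategory_left_perp P : subcategory (left_perp P).
Proof.
split=> [X X0 f x|X Y [e [e' eK e'K]] X_perp f y|X Y Z [e e_bij]].
- by rewrite [x]X0 raddf0.
- by have := X_perp (f \o e) (e' y); rewrite /= e'K.
have [e' [eK e'K]] := linear_bijective_inverse e_bij.
split=> [Z_perp|[X_perp Y_perp] f z].
  split=> f x; [have := Z_perp (f \o (proj1 _ _ \o e)) (e' (inj1 _ _ x))
               |have := Z_perp (f \o (proj2 _ _ \o e)) (e' (inj2 _ _ x))];
  by rewrite /= e'K.
rewrite -[z]eK [e z]pair_split !linearD.
have := X_perp (f \o (e' \o inj1 _ _)) (e z).1.
have := Y_perp (f \o (e' \o inj2 _ _)) (e z).2.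
by rewrite /= => -> ->; rewrite addr0.
Qed.

(** The modules that receive no nonzero map from a module of C. *)
Definition right_perp C : class A := fun Y => forall X, C X -> hom_zero X Y.

Lemma subcategory_right_perp C : subcategory (right_perp C).
Proof.
split=> [Y Y0 X _ f x|X Y [e e_bij] X_perp W CW f w|X Y Z [e e_bij]].
- exact: Y0.
- have [e' [eK e'K]] := linear_bijective_inverse e_bij.
  by have := X_perp W CW (e' \o f) w => /= /(congr1 e); rewrite e'K raddf0.
have [e' [eK e'K]] := linear_bijective_inverse e_bij.
split=> [Z_perp|[X_perp Y_perp] W CW f w].
  by split=> W CW f w;
    [have := Z_perp W CW (e' \o (inj1 _ _ \o f)) w
    |have := Z_perp W CW (e' \o (inj2 _ _ \o f)) w];
  move=> /= /(congr1 e); rewrite e'K raddf0 => -[].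
apply: (can_inj eK); rewrite raddf0 [LHS]surjective_pairing; congr pair.
  exact: (X_perp W CW (proj1 _ _ \o (e \o f))).
exact: (Y_perp W CW (proj2 _ _ \o (e \o f))).
Qed.

(** The inclusion of the torsion part of X is a right approximation of X. *)
Lemma torsion_right_approximation T : tors A T -> forall X,
  exists (C : fgmod A) (f : {linear C -> X}), right_approximation T f.
Proof.
move=> [F [_ _ TF0 TF]] X; have [tX [fX [i [p [T_tX F_fX [i_inj ip _]]]]]] := TF X.
exists tX, i; split=> // C g TC.
have [x|h hE] := @factor_through_injection _ _ _ _ i g i_inj; last by exists h.
by apply/ip; apply: (TF0 C fX TC F_fX (p \o g)).
Qed.

Variable P : fgmod A.
Hypotheses (P_simple : simple P) (P_projective : projective P).

Lemma decomposition_summands T (M K : fgmod A) m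
    (f : {linear (K * {ffun 'I_m -> P})%type -> M}) :
  subcategory T -> bijective f -> T M -> T K /\ T (pow_fg m P).
Proof.
case=> _ _ T_sum f_bij TM.
by apply/(T_sum K (pow_fg m P) M (isomorphic_of_bijective f_bij)).
Qed.

(** Otherwise P is a direct summand of X, hence belongs to T. *)
Lemma torsion_left_perp T X : tors A T -> ~ T P -> T X -> left_perp P X.
Proof.
move=> [F [T_sub _ _ _]] TP TX; apply: contrapT.
move=> /(projective_split P_simple P_projective)[K [h [i [s [sK i_inj hi h_ker]]]]].
have f_bij : bijective (copair i s).
  apply: inj_surj_bijective.
    apply: linear_inj => -[y p] /= is0.
    have p0 : p = 0 by move/(congr1 h): is0; rewrite linearD hi add0r sK raddf0.
    congr pair => //; apply: i_inj; rewrite raddf0.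
    by move: is0; rewrite p0 raddf0 addr0.
  move=> x; have [|y iy] := h_ker (x - s (h x)); first by rewrite linearB sK subrr.
  by exists (y, h x); rewrite /= iy subrK.
have [_ _ T_sum] := T_sub; apply: TP.
by have [/(_ TX)[]] := T_sum K P X (isomorphic_of_bijective f_bij).
Qed.

(** The torsion part of X for the new class is K, where K + P^m decomposes the
    torsion part of X for T; the torsion-free class is the right perp. *)
Lemma tors_inter_left_perp T : tors A T -> tors A (inter T (left_perp P)).
Proof.
move=> [F [T_sub F_sub TF0 TF]]; exists (right_perp (inter T (left_perp P))).
split; first exact/subcategory_inter/subcategory_left_perp.
- exact: subcategory_right_perp.
- by move=> X Y CX; apply.
move=> X; have [tX [fX [i [p [T_tX F_fX [i_inj ip p_surj]]]]]] := TF X.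
have [K [m [f [K_perp f_bij]]]] := decomposition P_simple P_projective tX.
have [TK _] := decomposition_summands T_sub f_bij T_tX.
pose j : {linear K -> X} := i \o (f \o inj1 _ _).
have j_closed : submod_closed [pred x | `[< exists y, j y = x >]].
  split; first by apply/asboolP; exists 0; rewrite raddf0.
  move=> a _ _ /asboolP[y <-] /asboolP[z <-]; apply/asboolP.
  by exists (a *: y + z); rewrite linearP.
have [Q [q [q_surj q_ker]]] := exists_quotient j_closed.
have Q_fg := fin_gen_surj q_surj (fgmodP X).
have [f' [fK f'K]] := linear_bijective_inverse f_bij.
exists K, (FgMod Q_fg), j, q; split=> //; last first.
  split=> // [y z|x]; last by rewrite q_ker inE; split=> /asboolP.
  by move=> /i_inj/(can_inj fK)[].
move=> Z [TZ Z_perp] g z.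
(* Q is an extension of fX by P^m: p' is the map from Q to fX, and e embeds
   P^m.  As Z has no nonzero map to fX, the map g factors through e. *)
have [|p' p'E] := @factor_through_surjection _ _ _ _ q p q_surj.
  move=> x /q_ker/asboolP[y <-]; apply/ip.
  by exists (f (inj1 _ _ y)).
have qi_inj r : q (i (f (inj2 _ _ r))) = 0 -> r = 0.
  by move=> /q_ker/asboolP[y /i_inj/(can_inj fK)[]].
pose e : {linear {ffun 'I_m -> P} -> Q} := q \o (i \o (f \o inj2 _ _)).
have e_inj : injective e by apply: linear_inj.
have [w|g' g'E] := @factor_through_injection _ _ _ _ e g e_inj.
  have [x qx] := q_surj (g w).
  have : p x = 0 by rewrite -p'E qx; apply: (TF0 Z fX TZ F_fX (p' \o g)).
  move=> /ip[t it]; exists (f' t).2; rewrite -qx -it -[t in RHS]f'K.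
  rewrite [f' t in RHS]pair_split !linearD.
  have -> : q (i (f (inj1 _ _ (f' t).1))) = 0 by apply/q_ker/asboolP; exists (f' t).1.
  by rewrite add0r.
rewrite -g'E; suff -> : g' z = 0 by rewrite raddf0.
apply/ffunP=> l; rewrite [RHS]ffunE.
exact: (Z_perp (coord_map P l \o g')).
Qed.
End Subcategories.

(** * Left approximations *)

Section LeftApproximation.
Context {k : fieldType} {A : falgType k}.
Variable P : fgmod A.
Hypotheses (P_simple : simple P) (P_projective : projective P).
Implicit Types (T : class A) (X Y : fgmod A).

(** If M + P^m is a left approximation of the regular module by T, then the
    modules of T without nonzero maps to P are quotients of powers of M. *)
Lemma inter_left_perp_generator T : tors A T -> functorially_finite T ->
  exists M : fgmod A, inter T (left_perp P) M /\
    forall X, inter T (left_perp P) X ->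
      exists n (h : {linear {ffun 'I_n -> M} -> X}), forall x, exists y, h y = x.
Proof.
move=> [F [T_sub _ _ _]] T_ff.
have [[T0 [u [T_T0 u_approx]]] _] := T_ff (regular (A := A)).
have [M [m [f [M_perp f_bij]]]] := decomposition P_simple P_projective T0.
have [TM _] := decomposition_summands T_sub f_bij T_T0.
have [f' [fK f'K]] := linear_bijective_inverse f_bij.
exists M; split=> // X [TX X_perp].
have [n [g g_gen]] := fgmodP X.
(* the generator g i is the image of u 1 under a map from T0 *)
have /choice[h hE] i : exists h : {linear T0 -> X}, h (u 1) = g i.
  have [h hE] := u_approx X (from_regular (g i)) TX.
  by exists h; rewrite -hE /= scale1r.
pose hM := sum_map (fun i => h i \o (f \o inj1 _ _) : {linear M -> X}).
pose hP := sum_map (fun i => h i \o (f \o inj2 _ _) : {linear {ffun 'I_m -> P} -> X}).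
have hMP x : exists y r, x = hM y + hP r.
  have [c ->] := g_gen x.
  exists [ffun i => (f' (c i *: u 1)).1], [ffun i => (f' (c i *: u 1)).2].
  rewrite -big_split; apply: eq_bigr => i _; rewrite !ffunE -hE -linearZ.
  by rewrite -[X in h i X]f'K {1}[f' _]pair_split !linearD.
have := superfluous_source_pow (superfluous_source_pow
  (superfluous_source_simple P_simple X_perp)).
move=> /(_ m n _ hM hP hMP) hM_surj.
by exists n, hM => x; have [y ->] := hM_surj x; exists y.
Qed.

(** The approximation is the map from P to M^n whose components span Hom(P, M)
    over k. *)
Lemma simple_left_approximation T : tors A T -> functorially_finite T ->
  exists (Q : fgmod A) (b : {linear P -> Q}),
    left_approximation (inter T (left_perp P)) b.
Proof.
move=> T_tors T_ff; have [F [T_sub _ _ _]] := T_tors.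
have [M [CM M_gen]] := inter_left_perp_generator T_tors T_ff.
have [p0 p0_neq0] := simple_nonzero P_simple.
have [d M_dim] := fin_gen_dim_le (fgmodP M).
(* as p0 generates P, a map from P to M is determined by its value at p0; the
   v j are values that span all the others *)
have [n [v [v_hom v_span]]] := dim_le_finite_span
  (fun x : over_k M => exists h : {linear P -> M}, h p0 = x) M_dim.
have [b bE] := choice v_hom.
exists (pow_fg n M), (tuple_map b); split.
  by apply: subcategory_pow CM; apply/subcategory_inter/subcategory_left_perp.
move=> X g CX; have [m [h h_surj]] := M_gen X CX.
have [g' g'E] := @P_projective (pow_fg m M) X h g h_surj.
have /choice[c cE] i : exists c : 'I_n -> k, g' p0 i = \sum_j c j *: v j.
  by apply: v_span; exists (coord_map M i \o g').
(* A-linear, because the coefficients in k are central in A *)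
have c_lin i : linear (fun y : {ffun 'I_n -> M} =>
    \sum_j (c i j *: (y j : over_k M) : M)).
  move=> a x y; rewrite scaler_sumr -big_split; apply: eq_bigr => j _.
  by rewrite !ffunE scalerDr k_scaleC.
pose t := tuple_map (fun i => mklinear (c_lin i)).
exists (h \o t) => x; suff -> : g x = h (t (tuple_map b x)) by [].
rewrite -g'E; congr (h _).
have [a ->] := simple_cyclic P_simple p0_neq0 x.
rewrite !linearZZ; congr (GRing.scale a _); apply/ffunP=> i; rewrite cE ffunE.
by apply: eq_bigr => j _; rewrite /= ffunE bE.
Qed.

(** A left approximation X -> K + P^m by T, followed on each factor P by an
    approximation of P, is one by the intersection. *)
Lemma ff_inter_left_perp T : tors A T -> functorially_finite T ->
  functorially_finite (inter T (left_perp P)).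
Proof.
move=> T_tors T_ff X; split; last first.
  apply: torsion_right_approximation.
  exact: tors_inter_left_perp.
have [F [T_sub _ _ _]] := T_tors.
have [Q [b [CQ b_approx]]] := simple_left_approximation T_tors T_ff.
have [[T0 [u [T_T0 u_approx]]] _] := T_ff X.
have [K [m [f [K_perp f_bij]]]] := decomposition P_simple P_projective T0.
have [TK _] := decomposition_summands T_sub f_bij T_T0.
have [f' [fK f'K]] := linear_bijective_inverse f_bij.
have C_sub := subcategory_inter T_sub (subcategory_left_perp P).
pose bm : {linear {ffun 'I_m -> P} -> {ffun 'I_m -> Q}} :=
  tuple_map (fun i => b \o coord_map P i).
exists (prod_fg K (pow_fg m Q)).
exists (pair_map (proj1 _ _) (bm \o proj2 _ _) \o (f' \o u)).
split; first by apply: subcategory_prod => //; apply: subcategory_pow.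
move=> Y g CY; have [h hE] := u_approx Y g CY.1.
have /choice[t tE] i : exists t : {linear Q -> Y},
    forall p, h (f (inj2 K _ (delta_map P i p))) = t (b p).
  exact: (b_approx Y (h \o (f \o (inj2 K _ \o delta_map P i)))).
exists (copair (h \o (f \o inj1 _ _)) (sum_map t)) => x.
rewrite hE -[u x in LHS]f'K [f' (u x) in LHS]pair_split !linearD.
congr (_ + _); rewrite [(f' (u x)).2 in LHS]sum_delta !linear_sum.
by apply: eq_bigr => i _; rewrite tE !ffunE.
Qed.
End LeftApproximation.

(** * The flip-flop decomposition *)

(** When Y is the complement of X in S, the bijection between S and the disjoint
    union of X and Y is forced, and the decomposition comes down to two
    properties of the order: a member of Y is contained in T exactly when it is
    contained in f(T), and no member of X is contained in a member of Y. *)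
Lemma flip_flop_criterion (U : Type) (S X : (U -> Prop) -> Prop)
    (f : sig X -> sig (minus S X)) :
  (forall C, X C -> S C) ->
  (forall T T', sub_incl T T' -> sub_incl (f T) (f T')) ->
  (forall (T : sig X) (T' : sig (minus S X)),
    incl (sval T') (sval T) <-> incl (sval T') (sval (f T))) ->
  (forall (T : sig X) (T' : sig (minus S X)), ~ incl (sval T) (sval T')) ->
  flip_flop_decomposition S f.
Proof.
move=> XS f_homo f_adj no_incl; split=> //.
pose h (T : sig S) : sig X + sig (minus S X) :=
  match pselect (X (sval T)) with
  | left XT => inl (exist _ (sval T) XT)
  | right NXT => inr (exist _ (sval T) (conj (svalP T) NXT))
  end.
pose h' (t : sig X + sig (minus S X)) : sig S :=
  match t with
  | inl T => exist _ (sval T) (XS _ (svalP T))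
  | inr T => exist _ (sval T) (svalP T).1
  end.
have hE T : underlying (h T) = sval T by rewrite /h; case: pselect.
exists h; split=> //.
  exists h' => [T|[] [T HT]].
  - by case: T => T HT; rewrite /h /=; case: pselect => ?; apply: eq_exist.
  - by rewrite /h /=; case: pselect => // ?; congr inl; apply: eq_exist.
  - by rewrite /h /=; case: pselect => [/HT.2 //|?]; congr inr; apply: eq_exist.
move=> T T'; rewrite /sub_incl -(hE T) -(hE T').
case: (h T) => t; case: (h T') => t' //=.
by split=> // /no_incl.
Qed.

Theorem proposition6p5 (k : fieldType) (A : falgType k) (A_basic : basic A)
    (P : fgmod A) (P_simple : simple P) (P_projective : projective P) :
  exists (f : sig (tors_at P) -> sig (minus (tors A) (tors_at P)))
         (f_ff : sig (ff_tors_at P) -> sig (minus (ff_tors A) (ff_tors_at P))),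
    [/\ forall T, sval (f T) = inter (sval T) (left_perp P),
        flip_flop_decomposition (tors A) f,
        forall T, sval (f_ff T) = inter (sval T) (left_perp P)
      & flip_flop_decomposition (ff_tors A) f_ff].
Proof.
have not_at T : ~ inter T (left_perp P) P.
  by case=> _; apply: left_perp_not_self.
have f_tors (T : sig (tors_at P)) :
    minus (tors A) (tors_at P) (inter (sval T) (left_perp P)).
  split; last by case=> _ /not_at.
  exact: tors_inter_left_perp (svalP T).1.
have f_ff_tors (T : sig (ff_tors_at P)) :
    minus (ff_tors A) (ff_tors_at P) (inter (sval T) (left_perp P)).
  have [[T_tors TP] [_ T_ff]] := svalP T.
  split; last by case=> -[_ /not_at].
  split; first exact: tors_inter_left_perp.
  exact: ff_inter_left_perp.
exists (fun T => exist _ _ (f_tors T)), (fun T => exist _ _ (f_ff_tors T)).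
split=> //; apply: flip_flop_criterion.
- by move=> T [].
- by move=> T T' TT' X [TX X_perp]; split=> //; apply: TT'.
- move=> T T'; have [T'_tors T'_at] := svalP T'.
  split=> [T'T X T'X|T'T X /T'T[] //]; split; first exact: T'T.
  apply: (torsion_left_perp P_simple P_projective T'_tors _ T'X) => T'P.
  by apply: T'_at.
- move=> T T' TT'; have [T'_tors T'_at] := svalP T'; apply: T'_at.
  by split=> //; apply: TT' (svalP T).2.
- by move=> T [].
- by move=> T T' TT' X [TX X_perp]; split=> //; apply: TT'.
- move=> T T'; have [[T'_tors T'_ff] T'_at] := svalP T'.
  split=> [T'T X T'X|T'T X /T'T[] //]; split; first exact: T'T.
  apply: (torsion_left_perp P_simple P_projective T'_tors _ T'X) => T'P.
  by apply: T'_at.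
- move=> T T' TT'; have [T'_ff T'_at] := svalP T'; apply: T'_at.
  by split=> //; split; [have [] := T'_ff | apply: TT' (svalP T).1.2].
Qed.
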